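(* Let $\xi=(G,\mathcal{L},\mathcal{A})$ be a reducible triplet. Then there are $r\ge 2$, direct sum decompositions $L_i=L_i^{(1)}\oplus\dots\oplus L_i^{(r)}$ for $i=1,\dots,n$, and irreducible triplets $\xi^{(s)}=(G,\mathcal{L}^{(s)},\mathcal{A}^{(s)})$ with $\mathcal{L}^{(s)}=(L_1^{(s)},\dots,L_n^{(s)})$, $s=1,\dots,r$, each of total dimension $\sum_i\dim L_i^{(s)}$ smaller than $\sum_i\dim L_i$, such that with respect to these decompositions (in bases of the $L_i$ composed of bases of the $L_i^{(s)}$) every operator $A_{ji}\in\mathcal{A}$ has the block upper triangular form $$A_{ji}=\begin{pmatrix}A_{ji}^{(1)} & * & \cdots & *\\ 0 & A_{ji}^{(2)} & * & \vdots\\ \vdots & & \ddots & *\\ 0&\cdots&0&A_{ji}^{(r)}\end{pmatrix},$$ where the $s$th diagonal block $A_{ji}^{(s)}:L_i^{(s)}\to L_j^{(s)}$ is the operator of the same edge in $\xi^{(s)}$. Moreover, $$\rho(\xi)=\max\{\rho(\xi^{(1)}),\dots,\rho(\xi^{(r)})\}.$$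
   Context: A triplet (system) $\xi=(G,\mathcal{L},\mathcal{A})$ consists of: a finite directed multigraph $G$ with vertices $1,\dots,n$ (loops and multiple edges allowed, finitely many edges); finite-dimensional real linear spaces $\mathcal{L}=(L_1,\dots,L_n)$, $L_i$ attached to vertex $i$ (some, but not all, of them may be $\{0\}$); and, for every edge from $i$ to $j$, a linear operator $A_{ji}:L_i\to L_j$. $\mathcal{A}$ is the family of all these operators. A path $\alpha$ is a sequence of consecutive edges; $|\alpha|$ is its number of edges. For a path $i_1\to i_2\to\dots\to i_{k+1}$ with operators $A_{i_{s+1}i_s}$, $\Pi_\alpha=A_{i_{k+1}i_k}\cdots A_{i_2i_1}:L_{i_1}\to L_{i_{k+1}}$. A multinorm is a collection of norms $\|\cdot\|_i$ on $L_i$, $i=1,\dots,n$; for an operator $A:L_i\to L_j$, $\|A\|=\sup_{\|x\|_i=1}\|Ax\|_j$ ($0$ if $L_i=\{0\}$). The joint spectral radius is $\rho(\xi)=\lim_{k\to\infty}\max_{|\alpha|=k}\|\Pi_\alpha\|^{1/k}$ (the limit exists and does not depend on the multinorm; a maximum over an empty set is $0$). A triplet $\xi'=(G,\mathcal{L}',\mathcal{A}')$ (same multigraph, spaces not all zero) is embedded in $\xi$ if $L_i'\subset L_i$ is a subspace for each $i$ and for every edge from $i$ to $j$ its operator in $\xi'$ is the restriction $A_{ji}|_{L_i'}$, which maps $L_i'$ into $L_j'$. The embedding is strict if $L_i'\ne L_i$ for at least one $i$. $\xi$ is reducible if it has a strictly embedded triplet, and irreducible otherwise. *)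

(* Defs.v *)
(* Joint spectral radius of a system of operators along the edges of a
   multigraph. *)
From HB Require Import structures.
From mathcomp Require Import all_boot all_order all_algebra.
From mathcomp Require Import all_classical all_reals all_analysis.

Set Implicit Arguments.
Unset Strict Implicit.
Unset Printing Implicit Defensive.

Import Order.TTheory GRing.Theory Num.Theory.
Import numFieldNormedType.Exports.

Local Open Scope classical_set_scope.
Local Open Scope ring_scope.

Record multigraph := Multigraph {
  nvert : nat;
  edge : finType;
  src : edge -> 'I_nvert;
  tgt : edge -> 'I_nvert }.

Section Systems.
Variables (R : realType) (G : multigraph).
Local Notation vertex := 'I_(nvert G).

Record triplet := Triplet {
  space : vertex -> vectType R;
  op : forall e : edge G, 'Hom(space (src e), space (tgt e));
  triplet_neq0 : exists i, (0 < \dim {: space i})%N }.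

Definition total_dim (xi : triplet) : nat :=
  (\sum_(i < nvert G) \dim {: space xi i})%N.

Inductive walk (i : vertex) : vertex -> Type :=
| walk_nil : walk i i
| walk_rcons (e : edge G) : walk i (src e) -> walk i (tgt e).

Fixpoint walk_size (i j : vertex) (w : walk i j) : nat :=
  match w with
  | walk_nil => 0
  | walk_rcons _ w' => (walk_size w').+1
  end.

Fixpoint walk_op (xi : triplet) (i j : vertex) (w : walk i j) :
    'Hom(space xi i, space xi j) :=
  match w in walk _ j return 'Hom(space xi i, space xi j) with
  | walk_nil => \1%VF
  | walk_rcons e w' => (op xi e \o walk_op xi w')%VF
  end.

Record is_norm (L : vectType R) (N : L -> R) : Prop := IsNorm {
  is_norm_eq0 : forall x, N x = 0 -> x = 0;
  is_normZ : forall (a : R) x, N (a *: x) = `|a| * N x;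
  is_norm_triangle : forall x y, N (x + y) <= N x + N y }.

Record multinorm (xi : triplet) := Multinorm {
  mnorm : forall i, space xi i -> R;
  mnormP : forall i, is_norm (mnorm (i := i)) }.

(* [sup set0 = 0], which gives the value 0 when the source space is {0}. *)
Definition opnorm (L M : vectType R) (NL : L -> R) (NM : M -> R)
    (A : 'Hom(L, M)) : R :=
  sup [set NM (A x) | x in [set x | NL x = 1]].

(* Maximum of the k-th roots of the norms of the products along the walks of
   length k: there are finitely many such walks, so the supremum is a maximum,
   and it is 0 if there are none. *)
Definition jsr_seq (xi : triplet) (N : multinorm xi) (k : nat) : R :=
  sup [set x | exists i j (w : walk i j), walk_size w = k /\
         x = opnorm (mnorm N (i := i)) (mnorm N (i := j)) (walk_op xi w)
               `^ k%:R^-1].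

(* The common limit of [jsr_seq N] for all multinorms [N]. *)
Definition jsr (xi : triplet) : R :=
  get [set rho | forall N : multinorm xi, jsr_seq N k @[k --> \oo] --> rho].

(* A triplet on subspaces of the spaces of [xi]; its operators need not be
   related to those of [xi]. *)
Record subtriplet (xi : triplet) := Subtriplet {
  sub_space : forall i, {vspace space xi i};
  sub_op : forall e : edge G,
    'Hom(subvs_of (sub_space (src e)), subvs_of (sub_space (tgt e)));
  sub_neq0 : exists i, (0 < \dim (sub_space i))%N }.

Lemma subtriplet_neq0 (xi : triplet) (eta : subtriplet xi) :
  exists i, (0 < \dim {: subvs_of (sub_space eta i)})%N.
Proof. by case: (sub_neq0 eta) => i Hi; exists i; rewrite dimvf. Qed.

Definition triplet_of_sub (xi : triplet) (eta : subtriplet xi) : triplet :=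
  @Triplet (fun i => subvs_of (sub_space eta i)) (sub_op eta)
    (subtriplet_neq0 eta).

Definition embedded (xi : triplet) (eta : subtriplet xi) : Prop :=
  forall (e : edge G) (x : subvs_of (sub_space eta (src e))),
    vsval (sub_op eta e x) = op xi e (vsval x).

Definition strict (xi : triplet) (eta : subtriplet xi) : Prop :=
  exists i, sub_space eta i <> fullv.

Definition reducible (xi : triplet) : Prop :=
  exists eta : subtriplet xi, embedded eta /\ strict eta.

Definition irreducible (xi : triplet) : Prop := ~ reducible xi.

End Systems.

Coercion triplet_of_sub : subtriplet >-> triplet.

Definition direct_decomp (R : realType) (L : vectType R) (r : nat)
    (W : 'I_r -> {vspace L}) : Prop :=
  (\sum_(s < r) W s)%VS = fullv /\ directv (\sum_(s < r) W s)%VS.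

(* The (s, t) block of [A] with respect to decompositions of its source and
   target spaces: [sumv_pi] is the projection onto [WM s] along the other
   summands. *)
Definition block (R : realType) (L M : vectType R) (r : nat)
    (WL : 'I_r -> {vspace L}) (WM : 'I_r -> {vspace M}) (A : 'Hom(L, M))
    (s t : 'I_r) : 'Hom(subvs_of (WL t), subvs_of (WM s)) :=
  (linfun (vsproj (WM s)) \o sumv_pi (\sum_(q < r) WM q)%VS s \o A
     \o linfun (@vsval _ _ (WL t)))%VF.

(* Main.v *)
Require Import Defs.
From HB Require Import structures.
From mathcomp Require Import all_boot all_order all_algebra.
From mathcomp Require Import all_classical all_reals all_analysis.
From mathcomp Require Import zify ring lra.

Set Implicit Arguments.
Unset Strict Implicit.
Unset Printing Implicit Defensive.

Import Order.TTheory GRing.Theory Num.Theory.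
Import VectorInternalTheory.
Import numFieldNormedType.Exports.
Local Open Scope classical_set_scope.
Local Open Scope ring_scope.

(** The decomposition comes from a composition series.  The families of
    subspaces, one at each vertex, that all operators preserve are ordered by
    inclusion, and a maximal chain [0 = V 0 < V 1 < ... < V r] up to the full
    family exists by induction on dimensions ([ex_flag]).  Taking [W s] to be a
    complement of [V s] in [V s.+1], every operator is block upper triangular,
    and its diagonal blocks are the operators induced on [V s.+1 / V s].  An
    embedded triplet of a diagonal triplet pulls back to an invariant family
    between [V s] and [V s.+1], so maximality of the chain is irreducibility of
    the diagonal triplets ([flag_triplet_irreducible]).  Reducibility of [xi]
    says precisely that the chain has at least two steps.

    For the spectral radii, the key fact is that [jsr xi] is the infimum of the
    numbers [c > 0] such that, for some multinorm, every single edge operator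
    has norm at most [c] ([jsrE]).  On the one hand such a [c] bounds the growth
    along walks, hence, all multinorms being equivalent, the limit superior of
    the [k]-th roots for any multinorm.  On the other hand, if all walks of one
    length [k] have norm at most [c ^+ k], then a weighted supremum over the
    shorter walks is a multinorm for which each edge has norm at most [c]
    ([ex_contracting_multinorm]).  The two together also show that the limit
    defining [jsr] exists and does not depend on the multinorm.

    For a block triangular triplet, the products along walks are block
    triangular with the products of the diagonal blocks on the diagonal, so
    each diagonal triplet grows no faster than [xi] ([jsr_block_le]).
    Conversely, multinorms contracting on the diagonal triplets add up, with
    rapidly increasing weights that make the blocks above the diagonal
    negligible, to a multinorm contracting on [xi] at nearly the largest of
    their rates ([jsr_le_blocks]). *)

(** * Norms on finite-dimensional spaces *)

Record is_seminorm (R : realType) (L : lmodType R) (p : L -> R) : Prop :=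
  IsSeminorm {
  is_seminormZ : forall (a : R) x, p (a *: x) = `|a| * p x;
  is_seminorm_triangle : forall x y, p (x + y) <= p x + p y }.

Section Seminorms.
Variables (R : realType) (L : lmodType R) (p : L -> R).
Hypothesis sp : is_seminorm p.

Lemma seminorm0 : p 0 = 0.
Proof. by rewrite -(scale0r 0) (is_seminormZ sp) normr0 mul0r. Qed.

Lemma seminormN x : p (- x) = p x.
Proof. by rewrite -scaleN1r (is_seminormZ sp) normrN1 mul1r. Qed.

Lemma seminorm_ge0 x : 0 <= p x.
Proof.
have := is_seminorm_triangle sp x (- x).
by rewrite subrr seminorm0 seminormN; lra.
Qed.

Lemma seminorm_sum I (r : seq I) (P : pred I) (F : I -> L) :
  p (\sum_(i <- r | P i) F i) <= \sum_(i <- r | P i) p (F i).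
Proof.
elim/big_ind2: _ => [|x a y b xa yb|//]; first by rewrite seminorm0.
exact: le_trans (is_seminorm_triangle sp a b) (lerD xa yb).
Qed.

Lemma seminorm_dist x y : `|p x - p y| <= p (x - y).
Proof.
have := is_seminorm_triangle sp (x - y) y.
have := is_seminorm_triangle sp (y - x) x.
rewrite !subrK -opprB seminormN => h1 h2.
by rewrite ler_norml; apply/andP; split; lra.
Qed.

End Seminorms.

Lemma norm_seminorm (R : realType) (L : vectType R) (N : L -> R) :
  is_norm N -> is_seminorm N.
Proof. by case. Qed.
Coercion norm_seminorm : is_norm >-> is_seminorm.

Lemma seminorm_comp (R : realType) (L M : lmodType R) (f : {linear L -> M})
    (p : M -> R) : is_seminorm p -> is_seminorm (p \o f).
Proof.
move=> sp; split=> [a x|x y] /=; first by rewrite linearZ (is_seminormZ sp).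
by rewrite linearD (is_seminorm_triangle sp).
Qed.

Lemma norm_gt0 (R : realType) (L : vectType R) (N : L -> R) x :
  is_norm N -> x != 0 -> 0 < N x.
Proof.
move=> nN x0; rewrite lt_neqAle (seminorm_ge0 nN) andbT eq_sym.
by apply: contra x0 => /eqP /(is_norm_eq0 nN) ->.
Qed.

Lemma row_entry_le_norm (R : realType) n (v : 'rV[R]_n) i : `|v 0 i| <= `|v|.
Proof.
have /mapP[j Hj ->] : `|v 0 i| \in [seq `|v x.1 x.2| | x : 'I_1 * 'I_n].
  by apply/mapP; exists (0, i) => //=; rewrite mem_enum.
rewrite [leRHS]/Num.norm /= mx_normrE.
by apply/bigmax_geP; right => /=; exists j.
Qed.

Lemma seminorm_row_le (R : realType) n (p : 'rV[R]_n -> R) :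
  is_seminorm p -> forall v, p v <= (\sum_i p (delta_mx 0 i)) * `|v|.
Proof.
move=> sp v; rewrite {1}(row_sum_delta v).
apply: le_trans (seminorm_sum sp _ _ _) _; rewrite mulr_suml.
apply: ler_sum => i _; rewrite (is_seminormZ sp) mulrC.
by rewrite ler_wpM2l ?seminorm_ge0 ?row_entry_le_norm.
Qed.

(** A seminorm is continuous for the supremum norm, so a norm attains a
    positive minimum on the compact unit sphere. *)
Lemma norm_row_ge (R : realType) n (N : 'rV[R]_n -> R) :
  is_norm N -> exists2 m, 0 < m & forall v, m * `|v| <= N v.
Proof.
move=> nN; set C := \sum_i N (delta_mx 0 i).
have C0 : 0 <= C by apply: sumr_ge0 => i _; exact: (seminorm_ge0 nN).
have contN : continuous N.
  move=> v; apply/(@cvgrPdist_le _ _ _ (nbhs v) (nbhs_filter v)) => e e0.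
  near=> w.
  apply: le_trans (seminorm_dist nN _ _) _.
  apply: le_trans (seminorm_row_le nN _) _; rewrite -/C.
  apply: (@le_trans _ _ (C * (e / (C + 1)))); last first.
    by rewrite mulrCA ger_pMr // ler_pdivrMr; lra.
  rewrite ler_wpM2l //; near: w; apply: cvgr_dist_le; first exact: cvg_id.
  by rewrite divr_gt0 //; lra.
have [[v0 v0S]|S0] := pselect (exists v : 'rV[R]_n, `|v| = 1); last first.
  exists 1 => // v; have [->|v0] := eqVneq v 0.
    by rewrite normr0 mulr0 (seminorm_ge0 nN).
  case: S0; exists (`|v|^-1 *: v).
  by rewrite normrZ normfV normr_id mulVf // normr_eq0.
have cS : compact [set v : 'rV[R]_n | `|v| = 1].
  apply: bounded_closed_compact.
    by exists 1; split=> // x x1 v /= ->; exact: ltW.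
  apply: (@closed_comp _ _ (fun v : 'rV[R]_n => `|v|) [set x | x = 1]).
    by move=> x _; exact: norm_continuous.
  exact: closed_eq.
have [|u uS minu] := compact_EVT_min (ex_intro _ v0 v0S) cS (f := N).
  exact: continuous_subspaceT.
exists (N u) => [|v].
  apply: norm_gt0 => //; apply: contraTneq isT => u0.
  by move: uS; rewrite inE /= u0 normr0 => /eqP; rewrite eq_sym oner_eq0.
have [->|v0'] := eqVneq v 0; first by rewrite normr0 mulr0 (seminorm_ge0 nN).
have nv : 0 < `|v| by rewrite normr_gt0.
have := minu (`|v|^-1 *: v).
rewrite inE /= normrZ normfV normr_id mulVf ?gt_eqF // => /(_ erefl).
by rewrite (is_normZ nN) normfV normr_id mulrC ler_pdivlMr.
Unshelve. all: by end_near. Qed.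

(** In coordinates, [p] is bounded by a multiple of the supremum norm, which is
    bounded by a multiple of [N]. *)
Lemma seminorm_le_norm (R : realType) (L : vectType R) (p N : L -> R) :
  is_seminorm p -> is_norm N -> exists2 K, 0 < K & forall x, p x <= K * N x.
Proof.
move=> sp nN.
have nN' : is_norm (N \o r2v).
  have [Z T] := seminorm_comp r2v nN.
  split=> // v /(is_norm_eq0 nN) v0; apply: (can_inj r2vK).
  by rewrite v0 linear0.
have [m m0 leN] := norm_row_ge nN'.
have sp' : is_seminorm (p \o r2v) by exact: (seminorm_comp r2v sp).
have := seminorm_row_le sp'; set C := \sum_i _ => leC.
have C0 : 0 <= C by apply: sumr_ge0 => i _; exact: (seminorm_ge0 sp').
exists ((C + 1) / m) => [|x]; first by rewrite divr_gt0 //; lra.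
have := leC (v2r x); have := leN (v2r x); rewrite /= v2rK => h1 h2.
apply: le_trans h2 _; rewrite -mulrA ler_pM //; first by lra.
by rewrite mulrC ler_pdivlMr // mulrC.
Qed.

Lemma ex_norm (R : realType) (L : vectType R) : exists N : L -> R, is_norm N.
Proof.
exists (fun x => `|v2r x|); split=> [x /normr0_eq0 x0|a x|x y].
- by apply: (can_inj v2rK); rewrite x0 linear0.
- by rewrite linearZ normrZ.
- by rewrite linearD ler_normD.
Qed.

(** * Operator norms and products along walks *)

Lemma sup_le_nonneg (R : realType) (E : set R) c :
  0 <= c -> ubound E c -> sup E <= c.
Proof.
move=> c0 Ec; have [->|/set0P E0] := eqVneq E set0; first by rewrite sup0.
exact: ge_sup.
Qed.

Lemma sup_nonneg (R : realType) (E : set R) : lbound E 0 -> 0 <= sup E.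
Proof.
move=> E0; have [hE|/sup_out -> //] := pselect (has_sup E).
by have [[x Ex] _] := hE; exact: le_trans (E0 x Ex) (sup_upper_bound hE Ex).
Qed.

Lemma finite_uniform_bound (R : realType) (I : finType) (P : I -> R -> Prop) :
  (forall i a b, a <= b -> P i a -> P i b) ->
  (forall i, exists2 K, 0 < K & P i K) ->
  exists2 K, 0 < K & forall i, P i K.
Proof.
move=> Pmono Pex.
have /choice[K PK] : forall i, exists K, 0 < K /\ P i K.
  by move=> i; have [K] := Pex i; exists K.
exists (1 + \sum_i K i) => [|i].
  by apply: ltr_pwDl => //; apply: sumr_ge0 => i _; apply: ltW; case: (PK i).
apply: (Pmono i (K i)); last by case: (PK i).
rewrite (bigD1 i) //= addrCA lerDl addr_ge0 // sumr_ge0 // => j _.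
by apply: ltW; case: (PK j).
Qed.

Lemma seminorm_linear_le (R : realType) (L M : vectType R) (f : 'Hom(L, M))
    (p : M -> R) (N : L -> R) : is_seminorm p -> is_norm N ->
  exists2 K, 0 < K & forall x, p (f x) <= K * N x.
Proof. by move=> sp nN; exact: (seminorm_le_norm (seminorm_comp f sp) nN). Qed.

Section OperatorNorm.
Variables (R : realType) (L M : vectType R) (NL : L -> R) (NM : M -> R).
Hypotheses (nL : is_norm NL) (nM : is_norm NM).
Implicit Type A : 'Hom(L, M).

Lemma opnorm_ge0 A : 0 <= opnorm NL NM A.
Proof. by apply: sup_nonneg => _ [x _ <-]; exact: (seminorm_ge0 nM). Qed.

Lemma opnorm_le A c : 0 <= c -> (forall x, NM (A x) <= c * NL x) ->
  opnorm NL NM A <= c.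
Proof.
move=> c0 Ac; apply: sup_le_nonneg => // _ [x /= x1 <-].
by rewrite -[leRHS]mulr1 -x1.
Qed.

(** The supremum in [opnorm] is over a bounded set because the spaces are
    finite-dimensional; this is what makes it an actual bound. *)
Lemma le_opnorm A x : NM (A x) <= opnorm NL NM A * NL x.
Proof.
have [->|x0] := eqVneq x 0.
  by rewrite linear0 (seminorm0 nM) (seminorm0 nL) mulr0.
have Nx : 0 < NL x by exact: norm_gt0.
rewrite -ler_pdivrMr // mulrC.
have -> : (NL x)^-1 * NM (A x) = NM (A ((NL x)^-1 *: x)).
  by rewrite linearZ (is_normZ nM) gtr0_norm // invr_gt0.
apply: ub_le_sup.
  have [K _ leK] := seminorm_linear_le A nM nL.
  by exists K => _ [y /= y1 <-]; rewrite -[leRHS]mulr1 -y1.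
exists ((NL x)^-1 *: x) => //=.
by rewrite (is_normZ nL) gtr0_norm ?invr_gt0 // mulVf // gt_eqF.
Qed.

End OperatorNorm.

Section Walks.
Variables (R : realType) (G : multigraph).
Local Notation vertex := 'I_(nvert G).

(** Walks grow at their end, whereas the contracting multinorm requires
    prolonging them at their beginning: this is concatenation after a
    single edge. *)
Fixpoint walk_cat (i j k : vertex) (v : walk i j) (w : walk j k) : walk i k :=
  match w in walk _ k return walk i k with
  | walk_nil => v
  | walk_rcons e w' => walk_rcons (walk_cat v w')
  end.

Lemma walk_size_cat (i j k : vertex) (v : walk i j) (w : walk j k) :
  walk_size (walk_cat v w) = (walk_size v + walk_size w)%N.
Proof. by elim: w => [|e w IHw] /=; rewrite ?addn0 // IHw addnS. Qed.

Lemma walk_op_cat (xi : triplet R G) (i j k : vertex) (v : walk i j)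
    (w : walk j k) x :
  walk_op xi (walk_cat v w) x = walk_op xi w (walk_op xi v x).
Proof. by elim: w => [|e w IHw] /=; rewrite ?id_lfunE // !comp_lfunE IHw. Qed.

Definition walk_edge (e : edge G) : walk (src e) (tgt e) :=
  walk_rcons (walk_nil (src e)).

Lemma walk_op_edge (xi : triplet R G) (e : edge G) x :
  walk_op xi (walk_edge e) x = op xi e x.
Proof. by rewrite /= comp_lfunE id_lfunE. Qed.

End Walks.

(** * The joint spectral radius as an infimum of contraction rates *)

Section Multinorms.
Variables (R : realType) (G : multigraph) (xi : triplet R G).
Local Notation vertex := 'I_(nvert G).
Implicit Types N : multinorm xi.

Lemma mnorm_ge0 N i (x : Defs.space xi i) : 0 <= mnorm N x.
Proof. exact: (seminorm_ge0 (mnormP N i)). Qed.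
#[local] Hint Resolve mnorm_ge0 : core.

Lemma ex_multinorm : exists N : multinorm xi, True.
Proof.
by exists (Multinorm (fun i => projT2 (cid (ex_norm (Defs.space xi i))))).
Qed.

Lemma multinorm_equiv N N' :
  exists2 K, 0 < K &
    forall i (x : Defs.space xi i), mnorm N x <= K * mnorm N' x.
Proof.
apply: finite_uniform_bound => [i a b ab leN x|i].
  by apply: le_trans (leN x) _; rewrite ler_wpM2r.
exact: seminorm_le_norm (mnormP N i) (mnormP N' i).
Qed.

Definition contracts N (c : R) : Prop :=
  forall e (x : Defs.space xi (src e)), mnorm N (op xi e x) <= c * mnorm N x.

Lemma contracts_le N (c c' : R) : c <= c' -> contracts N c -> contracts N c'.
Proof. by move=> cc' Nc e x; apply: le_trans (Nc e x) _; rewrite ler_wpM2r. Qed.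

Lemma ex_contracts N : exists2 c, 0 < c & contracts N c.
Proof.
apply: finite_uniform_bound => [e a b ab leN x|e].
  by apply: le_trans (leN x) _; rewrite ler_wpM2r.
exact: seminorm_linear_le (mnormP N (tgt e)) (mnormP N (src e)).
Qed.

Definition grows_at_most N (C c : R) : Prop :=
  forall i j (w : walk i j) (x : Defs.space xi i),
    mnorm N (walk_op xi w x) <= C * c ^+ walk_size w * mnorm N x.

Lemma contracts_grows N (c : R) :
  0 <= c -> contracts N c -> grows_at_most N 1 c.
Proof.
move=> c0 Nc i j; elim=> [|e w IHw] x /=.
  by rewrite id_lfunE expr0 !mul1r.
rewrite comp_lfunE; apply: le_trans (Nc _ _) _.
by rewrite mul1r exprS -mulrA ler_wpM2l // -[_ ^+ _]mul1r.
Qed.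

Lemma root_le (a d : R) k : (0 < k)%N -> 0 <= a -> 0 <= d ->
  (a `^ k%:R^-1 <= d) = (a <= d ^+ k).
Proof.
move=> k0 a0 d0; have kR : 0 < k%:R :> R by rewrite ltr0n.
have aE : (a `^ k%:R^-1) ^+ k = a.
  by rewrite -powR_mulrn ?powR_ge0 // -powRrM mulVf ?gt_eqF // powRr1.
by rewrite -{2}aE ler_pXn2r ?nnegrE // powR_ge0.
Qed.

(** Restates bounds on [jsr_seq] pointwise, so that neither roots nor suprema
    occur afterwards. *)
Lemma jsr_seq_leP N k (d : R) : (0 < k)%N -> 0 <= d ->
  jsr_seq N k <= d <->
  forall i j (w : walk i j), walk_size w = k ->
    forall x : Defs.space xi i, mnorm N (walk_op xi w x) <= d ^+ k * mnorm N x.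
Proof.
move=> k0 d0; split=> [jd i j w wk x|leN]; last first.
  apply: sup_le_nonneg => // _ [i [j [w [wk ->]]]].
  rewrite root_le ?opnorm_ge0 //; last exact: mnormP.
  by apply: opnorm_le; rewrite ?exprn_ge0 //; exact: leN.
apply: le_trans (le_opnorm (mnormP N i) (mnormP N j) _ _) _.
rewrite ler_wpM2r // -root_le ?opnorm_ge0 //; last exact: mnormP.
apply: le_trans jd; apply: ub_le_sup; last by exists i, j, w.
have [c c0 Nc] := ex_contracts N.
exists c => _ [i' [j' [w' [wk' ->]]]].
rewrite root_le ?opnorm_ge0 ?(ltW c0) //; last exact: mnormP.
apply: opnorm_le; rewrite ?exprn_ge0 ?ltW // => y.
by have := contracts_grows (ltW c0) Nc w' y; rewrite wk' mul1r.
Qed.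

Lemma jsr_seq_ge0 N k : 0 <= jsr_seq N k.
Proof. by apply: sup_nonneg => _ [i [j [w [_ ->]]]]; exact: powR_ge0. Qed.

(** Changing the multinorm costs a constant factor, whose [k]-th root tends
    to 1. *)
Lemma jsr_seq_eventually_le N (C c : R) N' d : 0 <= C -> 0 < c -> c < d ->
  grows_at_most N C c -> \forall k \near \oo, jsr_seq N' k <= d.
Proof.
move=> C0 c0 cd gN; have d0 : 0 < d by exact: lt_trans cd.
have [K1 K10 le1] := multinorm_equiv N' N.
have [K2 K20 le2] := multinorm_equiv N N'.
set B := K1 * C * K2 + 1.
have B0 : 0 < B by rewrite ltr_wpDl // !mulr_ge0 // ltW.
have : (c / d) ^+ k @[k --> \oo] --> (0 : R).
  by apply: cvg_expr; rewrite ger0_norm ?divr_ge0 ?ltW // ltr_pdivrMr ?mul1r.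
move=> /cvgr_le /(_ B^-1); rewrite invr_gt0 => /(_ B0) smallB.
near=> k; have k0 : (0 < k)%N by near: k; exact: nbhs_infty_gt.
have kB : B * c ^+ k <= d ^+ k.
  have : (c / d) ^+ k <= B^-1 by near: k.
  rewrite expr_div_n ler_pdivrMr ?exprn_gt0 // => h.
  by rewrite mulrC -ler_pdivlMr // mulrC.
apply/jsr_seq_leP; rewrite ?(ltW d0) // => i j w wk x.
apply: le_trans (le1 _ _) _.
apply: le_trans (ler_wpM2l (ltW K10) (gN _ _ w x)) _.
apply: (@le_trans _ _ (B * c ^+ k * mnorm N' x)); last by rewrite ler_wpM2r.
rewrite wk; apply: le_trans (_ : K1 * (C * c ^+ k * (K2 * mnorm N' x)) <= _).
  by rewrite ler_wpM2l ?(ltW K10) // ler_wpM2l // mulr_ge0 // exprn_ge0 // ltW.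
have -> : K1 * (C * c ^+ k * (K2 * mnorm N' x)) =
  K1 * C * K2 * c ^+ k * mnorm N' x by ring.
rewrite ler_wpM2r // ler_wpM2r ?exprn_ge0 ?ltW //.
by rewrite /B ltrDl.
Unshelve. all: by end_near. Qed.

(** The norm [sup (c ^- |w| * N (Pi_w x))] over the walks [w] of length less
    than [k] contracts by [c]: prolonging by an edge multiplies each term by at
    most [c], except for walks reaching length [k], whose contribution is
    bounded by that of the empty walk. *)
Lemma ex_contracting_multinorm N k (c : R) : (0 < k)%N -> 0 < c ->
  jsr_seq N k <= c -> exists N', contracts N' c.
Proof.
move=> k0 c0 /(jsr_seq_leP N k0 (ltW c0)) Nk.
pose E i (x : Defs.space xi i) := [set y | exists j (w : walk i j),
  (walk_size w < k)%N /\ y = mnorm N (walk_op xi w x) / c ^+ walk_size w].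
pose p i (x : Defs.space xi i) := sup (E i x).
(* Crude growth at some rate [b] makes the suprema finite. *)
have [b b0 Nb] := ex_contracts N.
have bE i (x : Defs.space xi i) : has_ubound (E i x).
  exists (\sum_(m < k) (b ^+ m * mnorm N x / c ^+ m)) => _ [j [w [wk ->]]].
  rewrite (bigD1 (Ordinal wk)) //=.
  apply: le_trans (_ : b ^+ walk_size w * mnorm N x / c ^+ walk_size w <= _).
    rewrite ler_wpM2r ?invr_ge0 ?exprn_ge0 ?(ltW c0) //.
    by have := contracts_grows (ltW b0) Nb w x; rewrite mul1r.
  rewrite lerDl sumr_ge0 // => m _.
  by rewrite divr_ge0 ?mulr_ge0 ?exprn_ge0 ?mnorm_ge0 ?(ltW b0) ?(ltW c0).
have le_p i j (w : walk i j) x : (walk_size w < k)%N ->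
    mnorm N (walk_op xi w x) / c ^+ walk_size w <= p i x.
  by move=> wk; apply: ub_le_sup => //; exists j, w.
have N_le_p i (x : Defs.space xi i) : mnorm N x <= p i x.
  by have := le_p i i (walk_nil i) x k0; rewrite /= id_lfunE expr0 divr1.
have p_le i (x : Defs.space xi i) d : (forall j (w : walk i j),
    (walk_size w < k)%N ->
    mnorm N (walk_op xi w x) / c ^+ walk_size w <= d) -> p i x <= d.
  move=> led; apply: ge_sup => [|_ [j [w [wk ->]]]]; last exact: led.
  by eexists; exists i, (walk_nil i).
have p_norm i : is_norm (p i).
  have pZ a x : p i (a *: x) <= `|a| * p i x.
    apply: p_le => j w wk; rewrite linearZ (is_normZ (mnormP N j)) -mulrA.
    by rewrite ler_wpM2l // le_p.
  have p0 x : 0 <= p i x by exact: le_trans (N_le_p i x).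
  split=> [x px|a x|x y].
  - apply: (is_norm_eq0 (mnormP N i)); apply/eqP.
    by rewrite eq_le mnorm_ge0 -px N_le_p.
  - apply/eqP; rewrite eq_le pZ /=; have [->|a0] := eqVneq a 0.
      by rewrite normr0 mul0r.
    rewrite mulrC -ler_pdivlMr ?normr_gt0 // mulrC -normfV.
    by have := pZ a^-1 (a *: x); rewrite scalerA mulVf // scale1r.
  - apply: p_le => j w wk.
    apply: le_trans (lerD (le_p _ _ w x wk) (le_p _ _ w y wk)).
    rewrite -mulrDl ler_wpM2r ?invr_ge0 ?exprn_ge0 ?(ltW c0) //.
    by rewrite linearD (is_norm_triangle (mnormP N j)).
exists (Multinorm p_norm) => e x /=; apply: p_le => j w wk.
have /= := walk_op_cat (walk_edge e) w x; rewrite comp_lfunE id_lfunE => <-.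
have := walk_size_cat (walk_edge e) w; rewrite /= add1n => we.
(* Either the prolonged walk still counts, or it has length exactly [k]. *)
have [ltk|] := ltnP (walk_size w).+1 k.
  have := le_p _ _ (walk_cat (walk_edge e) w) x; rewrite we => /(_ ltk).
  by rewrite exprS invfM mulrCA ler_pdivrMl // mulrC.
rewrite leq_eqVlt ltnNge wk orbF => /eqP kw.
rewrite ler_pdivrMr ?exprn_gt0 // mulrAC -exprS -kw.
apply: le_trans (Nk _ _ _ _ _) _; first by rewrite we.
by rewrite ler_wpM2l // exprn_ge0 // ltW.
Qed.

Definition rates : set R := [set c | 0 < c /\ exists N, contracts N c].

Lemma has_inf_rates : has_inf rates.
Proof.
split; last by exists 0 => c [/ltW].
have [N _] := ex_multinorm; have [c c0 Nc] := ex_contracts N.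
by exists c; split=> //; exists N.
Qed.

(** Any rate bounds the limit superior of [jsr_seq], and any number above a
    value of [jsr_seq] at a positive index is a rate. *)
Lemma jsr_seq_cvg N : jsr_seq N k @[k --> \oo] --> inf rates.
Proof.
apply/cvgrPdist_le => e e0.
have [c [c0 [N' N'c]] ce] := inf_adherent e0 has_inf_rates.
have up := jsr_seq_eventually_le N ler01 c0 ce (contracts_grows (ltW c0) N'c).
near=> k; rewrite distrC ler_norml; apply/andP; split; last first.
  by rewrite lerBlDl; near: k.
have k0 : (0 < k)%N by near: k; exact: nbhs_infty_gt.
rewrite lerBrDl -lerBrDr opprK.
apply: le_trans (_ : jsr_seq N k + e <= _) => //.
apply: ge_inf; first by case: has_inf_rates.
have d0 : 0 < jsr_seq N k + e by rewrite ltr_wpDl ?jsr_seq_ge0.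
split=> //; apply: (ex_contracting_multinorm k0 d0) (_ : jsr_seq N k <= _).
by rewrite lerDl ltW.
Unshelve. all: by end_near. Qed.

(** The limit exists and is the same for all multinorms, and at least one
    multinorm exists, so the choice in the definition of [jsr] is forced. *)
Lemma jsrE : jsr xi = inf rates.
Proof.
apply: get_unique => [N|r rP]; first exact: jsr_seq_cvg.
have [N _] := ex_multinorm.
exact: cvg_unique (rP N) (jsr_seq_cvg N).
Qed.

Lemma jsr_ge0 : 0 <= jsr xi.
Proof.
rewrite jsrE; apply: lb_le_inf => [|c [/ltW //]].
by case: has_inf_rates.
Qed.

Lemma jsr_le_rate N (c : R) : 0 < c -> contracts N c -> jsr xi <= c.
Proof.
move=> c0 Nc; rewrite jsrE; apply: ge_inf; first by case: has_inf_rates.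
by split=> //; exists N.
Qed.

Lemma jsr_lt_contracts c : jsr xi < c -> exists N, contracts N c.
Proof.
rewrite jsrE -subr_gt0 => c0.
have [d [_ [N Nd]]] := inf_adherent c0 has_inf_rates.
by rewrite addrC subrK => /ltW dc; exists N; exact: contracts_le Nd.
Qed.

(** Unlike contraction, growth up to a constant passes from a triplet to its
    diagonal blocks without forming quotient norms. *)
Lemma jsr_le_growth N (C c : R) : 0 <= C -> 0 < c -> grows_at_most N C c ->
  jsr xi <= c.
Proof.
move=> C0 c0 gN; apply/ler_addgt0Pl => e e0; rewrite jsrE.
apply: cvgr_to_le (jsr_seq_cvg N) _.
by apply: jsr_seq_eventually_le gN => //; rewrite ltrDr.
Qed.

End Multinorms.

(** * Triplets in block triangular form *)

Section Components.
Variables (R : realType) (L : vectType R) (r : nat) (W : 'I_r -> {vspace L}).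

Definition component (s : 'I_r) : 'Hom(L, subvs_of (W s)) :=
  (linfun (vsproj (W s)) \o sumv_pi (\sum_(q < r) W q)%VS s)%VF.

Lemma val_component s x :
  vsval (component s x) = sumv_pi (\sum_(q < r) W q)%VS s x.
Proof. by rewrite comp_lfunE lfunE /= vsprojK // memv_sum_pi. Qed.

Hypothesis dW : direct_decomp W.

Lemma sum_component x : \sum_s vsval (component s x) = x.
Proof.
under eq_bigr do rewrite val_component.
by apply: sumv_pi_sum; rewrite (proj1 dW) memvf.
Qed.

Lemma component_sum (u : 'I_r -> L) : (forall s, u s \in W s) ->
  forall s, vsval (component s (\sum_t u t)) = u s.
Proof.
move=> uW s; have [_ /directv_sum_unique dW2] := dW.
have := dW2 (fun s => vsval (component s (\sum_t u t))) u.
rewrite sum_component eqxx => /(_ (fun s _ => subvsP _) (fun s _ => uW s)).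
by move=> /esym/forall_inP /(_ s isT) /eqP.
Qed.

Lemma component_val s (y : subvs_of (W s)) t :
  vsval (component t (vsval y)) = if t == s then vsval y else 0.
Proof.
have -> : vsval y = \sum_q if q == s then vsval y else 0.
  by rewrite -big_mkcond /= big_pred1_eq.
rewrite (@component_sum (fun q => if q == s then vsval y else 0)).
  by rewrite -big_mkcond /= big_pred1_eq.
by move=> q; case: eqP => [->|_]; rewrite ?subvsP ?mem0v.
Qed.

Lemma component_val_id s (y : subvs_of (W s)) : component s (vsval y) = y.
Proof. by apply: val_inj; rewrite /= component_val eqxx. Qed.

Lemma component_val_neq s (y : subvs_of (W s)) t :
  t != s -> component t (vsval y) = 0.
Proof. by move=> /negPf ts; apply: val_inj; rewrite /= component_val ts. Qed.

End Components.

Lemma blockE (R : realType) (L M : vectType R) (r : nat)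
    (WL : 'I_r -> {vspace L}) (WM : 'I_r -> {vspace M}) (A : 'Hom(L, M)) s t y :
  block WL WM A s t y = component WM s (A (vsval y)).
Proof. by rewrite !comp_lfunE [linfun vsval y]lfunE. Qed.

Lemma component_op (R : realType) (L M : vectType R) (r : nat)
    (WL : 'I_r -> {vspace L}) (WM : 'I_r -> {vspace M}) (A : 'Hom(L, M)) s x :
  direct_decomp WL ->
  component WM s (A x) = \sum_t block WL WM A s t (component WL t x).
Proof.
move=> dWL; rewrite -{1}(sum_component dWL x) !linear_sum.
by apply: eq_bigr => t _; rewrite blockE.
Qed.

Section BlockTriangular.
Variables (R : realType) (G : multigraph) (xi : triplet R G) (r : nat).
Variable eta : 'I_r -> subtriplet xi.
Local Notation vertex := 'I_(nvert G).
Local Notation W := (fun i s => sub_space (eta s) i).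
Local Notation block_op e := (block (W (src e)) (W (tgt e)) (op xi e)).
Hypothesis dW : forall i, direct_decomp (W i).
Hypothesis block_lower : forall e (s t : 'I_r), (t < s)%N -> block_op e s t = 0.
Hypothesis block_diag : forall e s, block_op e s s = sub_op (eta s) e.

(** Starting from [W s], a walk never leaves the sum of the [W t] with [t <= s],
    and its component in [W s] evolves under the diagonal blocks alone. *)
Lemma walk_component s i j (w : walk i j) (y : subvs_of (W i s)) :
  component (W j) s (walk_op xi w (vsval y)) = walk_op (eta s) w y /\
  forall t : 'I_r, (s < t)%N -> component (W j) t (walk_op xi w (vsval y)) = 0.
Proof.
elim: w => [|e w [IHs IHt]] /=.
  rewrite !id_lfunE component_val_id //; split=> // t st.
  by rewrite component_val_neq // -val_eqE gtn_eqF.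
rewrite !(comp_lfunE (op xi e)) (comp_lfunE (sub_op (eta s) e)).
set z := walk_op xi w _ in IHs IHt *.
have zt (t : 'I_r) : (s <= t)%N ->
    component (W (tgt e)) t (op xi e z) = block_op e t t (component _ t z).
  move=> st; rewrite (component_op _ _ _ _ (dW (src e))) (bigD1 t) //=.
  rewrite big1 ?addr0 //.
  move=> q qt; have [tq|] := ltnP t q.
    by rewrite IHt ?linear0 // (leq_ltn_trans st tq).
  rewrite leq_eqVlt val_eqE (negPf qt) /= => qt'.
  by rewrite block_lower // zero_lfunE.
split=> [|t st]; first by rewrite zt // IHs block_diag.
by rewrite (zt t (ltnW st)) IHt // linear0.
Qed.

(** By [walk_component], operators along walks of [eta s] are those of [xi]
    followed by a projection, whose norm only costs a constant factor. *)
Lemma jsr_block_le s : jsr (eta s) <= jsr xi.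
Proof.
apply/ler_addgt0Pl => e e0; have c0 := ltr_pwDl e0 (jsr_ge0 xi).
have [N Nc] : exists N : multinorm xi, contracts N (e + jsr xi).
  by apply: jsr_lt_contracts; rewrite ltrDr.
have rN i : is_norm (fun y : Defs.space (eta s) i => mnorm N (vsval y)).
  split=> [y /(is_norm_eq0 (mnormP N i)) y0|a y|y z].
  - by apply: val_inj; rewrite /= y0.
  - by rewrite linearZ (is_normZ (mnormP N i)).
  - by rewrite linearD (is_norm_triangle (mnormP N i)).
have [K K0 leK] : exists2 K, 0 < K & forall i (x : Defs.space xi i),
    mnorm N (vsval (component (W i) s x)) <= K * mnorm N x.
  apply: finite_uniform_bound => [i a b ab leN x|i].
    by apply: le_trans (leN x) _; rewrite ler_wpM2r ?mnorm_ge0.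
  exact: seminorm_linear_le (rN i) (mnormP N i).
apply: (@jsr_le_growth _ _ _ (Multinorm rN) K) => //; first exact: ltW.
move=> i j w y /=; rewrite -(proj1 (walk_component w y)).
apply: le_trans (leK _ _) _; rewrite -mulrA ler_wpM2l ?(ltW K0) //.
by have := contracts_grows (ltW c0) Nc w (vsval y); rewrite mul1r.
Qed.

(** A block above the diagonal sends the component [t] to a component [s < t].
    With the weight [h ^+ s] on the component [s], this divides the norm by at
    least [h], up to the constant [K] bounding all blocks, so a large [h] makes
    the total contribution of these blocks arbitrarily small. *)
Lemma jsr_le_blocks (c : R) :
  0 <= c -> (forall s, jsr (eta s) <= c) -> jsr xi <= c.
Proof.
move=> c0 jc; apply/ler_addgt0Pl => e e0.
have cN s : exists N : multinorm (eta s), contracts N (e / 2 + c).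
  by apply: jsr_lt_contracts; have := jc s; lra.
pose N s := projT1 (cid (cN s)).
have Nc s : contracts (N s) (e / 2 + c) by exact: projT2 (cid (cN s)).
have [K K0 leK] : exists2 K, 0 < K & forall eg (st : 'I_r * 'I_r) y,
    mnorm (N st.1) (block_op eg st.1 st.2 y) <= K * mnorm (N st.2) y.
  apply: finite_uniform_bound => [eg a b ab leN st y|eg].
    by apply: le_trans (leN st y) _; rewrite ler_wpM2r ?mnorm_ge0.
  apply: finite_uniform_bound => [st a b ab leN y|st].
    by apply: le_trans (leN y) _; rewrite ler_wpM2r ?mnorm_ge0.
  exact: seminorm_linear_le (mnormP (N st.1) _) (mnormP (N st.2) _).
(* Large enough for the blocks above the diagonal, at most [r] in a column, to
   add at most [e / 2] to the rate. *)
pose h : R := 1 + 2 * K * r%:R / e.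
have h1 : 1 <= h by rewrite lerDl divr_ge0 ?mulr_ge0 ?(ltW K0) ?(ltW e0).
have h0 : 0 < h by exact: lt_le_trans h1.
pose p i (x : Defs.space xi i) :=
  \sum_(s < r) h ^+ s * mnorm (N s) (component (W i) s x).
have p_norm i : is_norm (@p i).
  split=> [x /eqP|a x|x y].
  - rewrite psumr_eq0 => [/allP px|s _]; last first.
      by rewrite mulr_ge0 ?exprn_ge0 ?mnorm_ge0 ?(ltW h0).
    rewrite -(sum_component (dW i) x) big1 // => s _.
    have := px s (mem_index_enum s); rewrite /= mulf_eq0 expf_eq0 gt_eqF //.
    rewrite andbF /= => /eqP /(is_norm_eq0 (mnormP (N s) i)) ->.
    by rewrite linear0.
  - rewrite /p mulr_sumr; apply: eq_bigr => s _.
    by rewrite linearZ (is_normZ (mnormP (N s) i)) mulrCA.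
  - rewrite /p -big_split; apply: ler_sum => s _ /=.
    by rewrite -mulrDr ler_wpM2l ?exprn_ge0 ?(ltW h0) // linearD
      (is_norm_triangle (mnormP (N s) i)).
apply: (@jsr_le_rate _ _ _ (Multinorm p_norm)); first exact: ltr_pwDl.
move=> eg x /=.
pose n t := mnorm (N t) (component (W (src eg)) t x).
have n0 t : 0 <= n t by exact: mnorm_ge0.
have le_comp (s : 'I_r) : mnorm (N s) (component (W (tgt eg)) s (op xi eg x)) <=
    \sum_(t < r) (if t == s then (e / 2 + c) * n t
            else if (s < t)%N then K * n t else 0).
  rewrite (component_op _ _ _ _ (dW (src eg))).
  apply: le_trans (seminorm_sum (mnormP (N s) _) _ _ _) _.
  apply: ler_sum => t _; case: eqP => [->|ts]; first by rewrite block_diag Nc.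
  case: ltnP => [_|]; first exact: (leK eg (s, t)).
  rewrite leq_eqVlt => /orP[/eqP/val_inj//|ts'].
  by rewrite block_lower // zero_lfunE (seminorm0 (mnormP (N s) _)).
apply: le_trans (_ : \sum_(s < r) h ^+ s * \sum_(t < r)
           (if t == s then (e / 2 + c) * n t
            else if (s < t)%N then K * n t else 0) <= _).
  by apply: ler_sum => s _; rewrite ler_wpM2l ?exprn_ge0 ?(ltW h0).
under eq_bigr do rewrite mulr_sumr.
rewrite exchange_big /= /p mulr_sumr; apply: ler_sum => t _.
rewrite -/(n t) (bigD1 t) //= eqxx.
(* It remains to bound, for each [t], the sum over the rows of its column. *)
pose B := K * n t * (h ^+ t / h).
have B0 : 0 <= B.
  by rewrite !mulr_ge0 ?invr_ge0 ?exprn_ge0 ?n0 ?(ltW K0) ?(ltW h0).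
apply: le_trans (_ : h ^+ t * ((e / 2 + c) * n t) + r%:R * B <= _).
  rewrite lerD2l; apply: le_trans (_ : \sum_(s < r) B <= _); last first.
    by rewrite sumr_const card_ord mulr_natl.
  rewrite [leRHS](bigD1 t) //= ler_wpDl //; apply: ler_sum => s st.
  rewrite eq_sym (negPf st); case: ltnP => [ltst|_]; last by rewrite mulr0.
  rewrite mulrC ler_wpM2l ?mulr_ge0 ?n0 ?(ltW K0) //.
  by rewrite ler_pdivlMr // -exprSr ler_weXn2l.
have le_e : r%:R * (K / h) <= e / 2.
  rewrite mulrA ler_pdivrMr // /h mulrDr mulr1.
  have -> : e / 2 * (2 * K * r%:R / e) = r%:R * K by field; rewrite gt_eqF.
  by rewrite lerDr; lra.
have -> : r%:R * B = r%:R * (K / h) * (h ^+ t * n t) by rewrite /B; ring.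
rewrite mulrCA -mulrDl [leRHS]mulrA.
apply: le_trans (ler_wpM2r _ (_ : _ <= e + c)) _ => //.
- by rewrite mulr_ge0 ?exprn_ge0 ?n0 ?(ltW h0).
- lra.
- by rewrite mulrA.
Qed.

Lemma jsr_block_triangular : jsr xi = \big[Num.max/0]_(s < r) jsr (eta s).
Proof.
apply/eqP; rewrite eq_le; apply/andP; split; last first.
  by apply/bigmax_leP; split=> [|s _]; [exact: jsr_ge0|exact: jsr_block_le].
apply: jsr_le_blocks => [|s]; first exact: bigmax_ge_id.
exact: le_bigmax.
Qed.

End BlockTriangular.

(** * Composition series of invariant families of subspaces *)

Section FlagDecomposition.
Variables (R : realType) (L : vectType R) (r : nat) (V : nat -> {vspace L}).
Hypothesis V0 : V 0 = 0%VS.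
Hypothesis Vr : V r = fullv.
Hypothesis Vle : forall m, (m < r)%N -> (V m <= V m.+1)%VS.

Definition flag_step (s : 'I_r) : {vspace L} := (V s.+1 :\: V s)%VS.

Lemma flag_mono m n : (m <= n)%N -> (n <= r)%N -> (V m <= V n)%VS.
Proof.
elim: n => [|n IHn]; first by rewrite leqn0 => /eqP ->.
rewrite leq_eqVlt ltnS => /orP[/eqP -> //|mn] nr.
exact: subv_trans (IHn mn (ltnW nr)) (Vle nr).
Qed.

Lemma sum_flag_step m : (m <= r)%N ->
  (\sum_(s < r | (s < m)%N) flag_step s)%VS = V m.
Proof.
move=> mr.
rewrite -(big_ord_widen_cond _ xpredT (fun s => V s.+1 :\: V s)%VS) //.
elim: m mr => [|m IHm] mr; first by rewrite big_ord0 V0.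
rewrite big_ord_recr /= IHm ?(ltnW mr) // addvC addv_diff.
by apply/addv_idPl; exact: Vle.
Qed.

Lemma sum_dim_flag_step : (\sum_(s < r) \dim (flag_step s))%N = \dim {: L}.
Proof.
have dimV m : (m <= r)%N ->
    (\sum_(s < m) \dim (V s.+1 :\: V s)%VS)%N = \dim (V m).
  elim: m => [|m IHm] mr; first by rewrite big_ord0 V0 dimv0.
  rewrite big_ord_recr /= IHm ?(ltnW mr) //.
  by rewrite -(dimv_cap_compl (V m.+1) (V m)) (capv_idPr (Vle mr)).
by rewrite [LHS]dimV // Vr.
Qed.

Lemma flag_direct_decomp : direct_decomp flag_step.
Proof.
have sumT : (\sum_(s < r) flag_step s)%VS = fullv.
  rewrite -Vr -(sum_flag_step (leqnn r)); apply: eq_bigl => s.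
  by rewrite ltn_ord.
by split=> //; rewrite directvE /= sumT sum_dim_flag_step.
Qed.

Lemma component_flag_eq0 (s : 'I_r) x :
  x \in V s -> component flag_step s x = 0.
Proof.
rewrite -(sum_flag_step (ltnW (ltn_ord s))) => /memv_sumP[u uW ->].
rewrite big_mkcond; apply: val_inj => /=.
rewrite (component_sum flag_direct_decomp
  (u := fun q => if (q < s)%N then u q else 0)).
  by rewrite ltnn.
by move=> q; case: ifP => [/uW //|_]; rewrite mem0v.
Qed.

(** The components after [s] vanish, and those before [s] lie in [V s]. *)
Lemma sub_component_flag (s : 'I_r) x :
  x \in V s.+1 -> x - vsval (component flag_step s x) \in V s.
Proof.
move=> xV; rewrite -{1}(sum_component flag_direct_decomp x) (bigD1 s) //=.
rewrite addrAC subrr add0r memv_suml // => q qs.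
have [ltqs|] := ltnP q s.
  apply: subvP (subvsP (component flag_step q x)).
  exact: subv_trans (diffvSl _ _) (flag_mono ltqs (ltnW (ltn_ord s))).
rewrite leq_eqVlt eq_sym val_eqE (negPf qs) /= => ltsq.
rewrite component_flag_eq0 ?mem0v //.
exact: subvP (flag_mono ltsq (ltnW (ltn_ord q))) _ xV.
Qed.

Lemma flag_step_cap (s : 'I_r) x : x \in flag_step s -> x \in V s -> x = 0.
Proof.
move=> xW xV; apply/eqP.
by rewrite -memv0 -(capv_diff (V s.+1) (V s)) memv_cap xW.
Qed.

End FlagDecomposition.

Section Families.
Variables (R : realType) (G : multigraph) (xi : triplet R G).
Local Notation family := (forall i, {vspace Defs.space xi i}).
Implicit Types U V Z : family.

Definition invariant_family V :=
  forall e x, x \in V (src e) -> op xi e x \in V (tgt e).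

Definition family_le U V := forall i, (U i <= V i)%VS.

Definition family_dim V : nat := (\sum_i \dim (V i))%N.

(** Irreducibility of the quotient [V / U], without forming quotients. *)
Definition covers U V :=
  [/\ invariant_family V, family_le U V, ~ family_le V U &
   forall Z, invariant_family Z -> family_le U Z -> family_le Z V ->
     family_le Z U \/ family_le V Z].

Lemma family_dim_lt U V :
  family_le U V -> ~ family_le V U -> (family_dim U < family_dim V)%N.
Proof.
move=> UV nVU; rewrite ltn_neqAle leq_sum ?andbT => [|i _]; last exact: dimvS.
apply/eqP => eqd; apply: nVU => i.
have /leqif_sum := fun i (_ : true) => dimv_leqif_sup (UV i).
move=> /leqifP; rewrite -/(family_dim _) eqd.
by case: ifP => [/forallP /(_ i)|_]; rewrite ?ltnn.
Qed.

(** Descend to an invariant family of least dimension properly above [U]. *)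
Lemma ex_cover U V : invariant_family V -> family_le U V -> ~ family_le V U ->
  exists Z, covers U Z.
Proof.
have [n] := ubnP (family_dim V); elim: n V => // n IHn V Vn invV UV nVU.
have [?|ncov] := pselect (covers U V); first by exists V.
have [Z] : exists Z, [/\ invariant_family Z, family_le U Z, family_le Z V,
    ~ family_le Z U & ~ family_le V Z].
  apply: contrapT => nZ; apply: ncov; split=> // Z invZ UZ ZV.
  by apply: contrapT => /not_orP[ZU VZ]; apply: nZ; exists Z.
case=> invZ UZ ZV nZU nVZ; apply: (IHn Z) => //.
exact: leq_trans (family_dim_lt ZV nVZ) _.
Qed.

(** Climb through covers until the full family is reached; the codimension
    decreases at each step. *)
Lemma ex_flag U : invariant_family U -> exists r (V : nat -> family),
  [/\ V 0 = U, V r = (fun i => fullv) &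
      forall s, (s < r)%N -> covers (V s) (V s.+1)].
Proof.
set full : family := fun i => fullv.
have Ufull W : family_le W full by move=> i; exact: subvf.
have [n] := ubnP (family_dim full - family_dim U)%N.
elim: n U => // n IHn U Un invU.
have [UT|nUT] := pselect (family_le full U).
  exists 0, (fun=> U); split=> //; apply: functional_extensionality_dep => i.
  by apply: subv_anti; rewrite UT Ufull.
have [|Z UZ] := @ex_cover U full _ (Ufull U) nUT.
  by move=> e x _; rewrite memvf.
have [invZ leUZ nZU _] := UZ.
have [|r [V [V0 Vr Vcov]]] := IHn Z _ invZ.
  have := family_dim_lt leUZ nZU.
  have : (family_dim Z <= family_dim full)%N.
    by apply: leq_sum => i _; rewrite dimvS ?subvf.
  move: Un; lia.
exists r.+1, (fun m => if m is m'.+1 then V m' else U); split=> // -[_|s sr] /=.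
  by rewrite V0.
exact: Vcov.
Qed.

End Families.

Section FlagTriplets.
Variables (R : realType) (G : multigraph) (xi : triplet R G) (r : nat).
Variable V : nat -> forall i, {vspace Defs.space xi i}.
Hypothesis V0 : V 0 = (fun i => 0%VS).
Hypothesis Vr : V r = (fun i => fullv).
Hypothesis Vcov : forall s, (s < r)%N -> covers (V s) (V s.+1).
Local Notation W i := (flag_step (r := r) (fun m => V m i)).

Let V0i i : V 0 i = 0%VS. Proof. by rewrite V0. Qed.
Let Vri i : V r i = fullv. Proof. by rewrite Vr. Qed.
Let Vle i m : (m < r)%N -> (V m i <= V m.+1 i)%VS.
Proof. by case/Vcov. Qed.

Lemma flag_direct_decomp_family i : direct_decomp (W i).
Proof. exact: flag_direct_decomp (V0i i) (Vri i) (@Vle i). Qed.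

Lemma flag_step_neq0 (s : 'I_r) : exists i, (0 < \dim (W i s))%N.
Proof.
have [_ _ nle _] := Vcov (ltn_ord s); apply: contrapT => W0; apply: nle => i.
rewrite -diffv_eq0 -dimv_eq0 -leqn0 leqNgt; apply/negP => Wi.
by apply: W0; exists i.
Qed.

Definition flag_triplet (s : 'I_r) : subtriplet xi :=
  @Subtriplet R G xi (fun i => W i s)
    (fun e => block (W (src e)) (W (tgt e)) (op xi e) s s)
    (flag_step_neq0 s).

Lemma flag_invariant m : (m <= r)%N -> invariant_family (V m).
Proof.
case: m => [|m] mr; last by case: (Vcov mr).
by move=> e x; rewrite V0 !memv0 => /eqP ->; rewrite linear0.
Qed.

Lemma flag_block_lower e (s t : 'I_r) : (t < s)%N ->
  block (W (src e)) (W (tgt e)) (op xi e) s t = 0.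
Proof.
move=> ts; apply/lfunP => y; rewrite blockE zero_lfunE.
apply: (component_flag_eq0 (V0i _) (Vri _) (@Vle _)).
apply: (subvP (flag_mono (@Vle (tgt e)) ts (ltnW (ltn_ord s)))).
apply: (flag_invariant (ltn_ord t)).
exact: subvP (diffvSl _ _) _ (subvsP y).
Qed.

(** A strictly embedded triplet, added to [V s], would be an invariant family
    strictly between [V s] and [V s.+1]. *)
Lemma flag_triplet_irreducible s : irreducible (flag_triplet s).
Proof.
case=> eta [emb [i0 neqT]].
have [_ _ _ cov] := Vcov (ltn_ord s).
pose U i : {vspace subvs_of (W i s)} := sub_space eta i.
(* The preimage in [V s.+1] of the embedded triplet. *)
pose Y i := (V s i + linfun vsval @: U i)%VS.
have YV : family_le Y (V s.+1).
  move=> i; rewrite subv_add Vle // ; apply/subvP => _ /memv_imgP[y _ ->].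
  by rewrite lfunE; exact: subvP (diffvSl _ _) _ (subvsP y).
have invY : invariant_family Y.
  move=> e x /memv_addP[v vV [_ /memv_imgP[y yU ->] ->]].
  rewrite lfunE linearD /= memvD //.
    apply: subvP (addvSl _ _) _ _; apply: flag_invariant => //.
    exact: ltnW.
  set z := op xi e _.
  have zV : z \in V s.+1 (tgt e).
    apply: (flag_invariant (ltn_ord s)).
    exact: subvP (diffvSl _ _) _ (subvsP y).
  rewrite -(subrK (vsval (component (W (tgt e)) s z)) z).
  apply: memv_add; first exact: (sub_component_flag (V0i _) (Vri _) (@Vle _)).
  rewrite -[vsval _](lfunE (@vsval _ _ _)) memv_img // -blockE.
  have := emb e (vsproj (U (src e)) y).
  rewrite (vsprojK yU) => <-; exact: subvsP.
have [|YVs|VY] := cov Y invY _ YV; first by move=> i; exact: addvSl.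
  have [i] := sub_neq0 eta; rewrite lt0n dimv_eq0 -/(U i) => /negP; apply.
  apply/eqP/vspaceP => y; apply/idP/idP => [yU|]; last first.
    by rewrite memv0 => /eqP ->; rewrite mem0v.
  rewrite memv0; apply/eqP/val_inj.
  apply: (@flag_step_cap _ _ _ (fun m => V m i) s) => //=; first exact: subvsP.
  apply: (subvP (YVs i)); apply: (subvP (addvSr _ _)).
  by rewrite -[vsval _](lfunE (@vsval _ _ _)) memv_img.
apply: neqT; apply/vspaceP => y; rewrite memvf -/(U i0).
have /memv_addP[v vV [_ /memv_imgP[z zU ->]]] : vsval y \in Y i0.
  by apply: (subvP (VY i0)); exact: subvP (diffvSl _ _) _ (subvsP y).
rewrite lfunE /= => yE; have -> : y = z; last exact: zU.
apply/val_inj/eqP; rewrite -subr_eq0; apply/eqP.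
apply: (@flag_step_cap _ _ _ (fun m => V m i0) s) => /=.
  by rewrite memvB // subvsP.
by rewrite yE addrK.
Qed.

Lemma sum_total_dim_flag :
  (\sum_(s < r) total_dim (flag_triplet s))%N = total_dim xi.
Proof.
rewrite exchange_big; apply: eq_bigr => i _ /=.
rewrite -(sum_dim_flag_step (V0i i) (Vri i) (@Vle i)).
by apply: eq_bigr => s _; rewrite dimvf.
Qed.

Lemma total_dim_gt0 (zeta : triplet R G) : (0 < total_dim zeta)%N.
Proof.
have [i zi] := triplet_neq0 zeta.
by rewrite /total_dim (bigD1 i) //= ltn_addr.
Qed.

Lemma total_dim_flag_lt s : (2 <= r)%N ->
  (total_dim (flag_triplet s) < total_dim xi)%N.
Proof.
move=> r2; have [t ts] : exists t, t != s.
  have [s0|s0] := posnP s.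
    by exists (Ordinal r2); rewrite -val_eqE /= s0.
  by exists (Ordinal (ltnW r2)); rewrite -val_eqE /= ltn_eqF.
rewrite -sum_total_dim_flag (bigD1 s) //= -[X in (X < _)%N]addn0 ltn_add2l.
by rewrite (bigD1 t) //= ltn_addr // total_dim_gt0.
Qed.

(** A single step from the zero family to the full one leaves no room for the
    spaces of a strictly embedded triplet. *)
Lemma flag_size_ge2 : reducible xi -> (2 <= r)%N.
Proof.
case=> eta [emb [i neqT]].
have inv : invariant_family (sub_space eta).
  move=> e x xU; have := emb e (vsproj _ x); rewrite vsprojK // => <-.
  exact: subvsP.
rewrite ltnNge leq_eqVlt ltnS leqn0; apply/negP => /orP[/eqP r1|/eqP r0].
  have r_gt0 : (0 < r)%N by rewrite r1.
  have [_ _ _ cov] := Vcov r_gt0; have V1 : V 1 = V r by rewrite r1.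
  case: (cov _ inv) => [j|j|U0|UT].
  - by rewrite V0 sub0v.
  - by rewrite V1 Vr subvf.
  - have [j] := sub_neq0 eta.
    by have := U0 j; rewrite V0 subv0 => /eqP ->; rewrite dimv0.
  - by apply: neqT; apply: subv_anti; rewrite subvf -(Vri i) -V1 UT.
have [j] := triplet_neq0 xi.
by rewrite -(Vri j) r0 V0i dimv0.
Qed.

End FlagTriplets.

Theorem corollary2 (R : realType) (G : multigraph) (xi : triplet R G)
    (xi_red : reducible xi) :
  exists (r : nat) (eta : 'I_r -> subtriplet xi),
    [/\ (2 <= r)%N,
        forall i, direct_decomp (fun s => sub_space (eta s) i),
        forall s, irreducible (eta s) /\ (total_dim (eta s) < total_dim xi)%N,
        forall (e : edge G) (s t : 'I_r),
          let A_st := block (fun q => sub_space (eta q) (src e))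
                            (fun q => sub_space (eta q) (tgt e))
                            (op xi e) in
          ((t < s)%N -> A_st s t = 0) /\ A_st s s = sub_op (eta s) e
      & jsr xi = \big[Num.max/0]_(s < r) jsr (eta s)].
Proof.
have [|r [V [V0 Vr Vcov]]] := @ex_flag R G xi (fun=> 0%VS).
  by move=> e x; rewrite !memv0 => /eqP ->; rewrite linear0.
have r2 := flag_size_ge2 V0 Vr Vcov xi_red.
exists r, (flag_triplet Vcov); split=> //.
- by move=> i; exact: flag_direct_decomp_family.
- move=> s; split; first exact: flag_triplet_irreducible.
  exact: total_dim_flag_lt.
- by move=> e s t A_st; split=> // ts; exact: flag_block_lower.
- apply: jsr_block_triangular => // [i|e s t ts].
    exact: flag_direct_decomp_family.
  exact: flag_block_lower.
Qed.
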